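(* Up to scalars, $L_{0,0}$ is the unique $\mathrm{ad}$-locally finite element of $\mathcal{B}$. Furthermore, $\mathcal{B}$ does not have a nonzero $\mathrm{ad}$-locally nilpotent element, and thus the inner automorphism group $\mathrm{Int}\,\mathcal{B}$ of $\mathcal{B}$ is trivial.
   Context: Let $\mathbb{F}$ be an algebraically closed field of characteristic zero and $\mathbb{Z}_+=\{0,1,2,\dots\}$. $\mathcal{B}$ is the Lie algebra over $\mathbb{F}$ with basis $\{L_{\alpha,i}\mid \alpha\in\mathbb{Z},\, i\in\mathbb{Z}_+\}$ and bracket $$[L_{\alpha,i},L_{\beta,j}]=\big((\alpha-1)(j+1)-(\beta-1)(i+1)\big)L_{\alpha+\beta,i+j}.$$ For $S\in\mathcal{B}$ write $\mathrm{ad}_S(v)=[S,v]$. An element $S\in\mathcal{B}$ is $\mathrm{ad}$-locally finite if for every $v\in\mathcal{B}$ the subspace $\mathrm{span}\{\mathrm{ad}_S^m\cdot v\mid m\in\mathbb{Z}_+\}$ is finite dimensional. It is $\mathrm{ad}$-locally nilpotent if for every $v\in\mathcal{B}$ there exists $N>0$ with $\mathrm{ad}_S^N\cdot v=0$. The inner automorphism group $\mathrm{Int}\,\mathcal{B}$ is the subgroup of the automorphism group of $\mathcal{B}$ generated by the exponentials $\exp(\mathrm{ad}_x)$ for $\mathrm{ad}$-locally nilpotent elements $x\in\mathcal{B}$. The phrase ''up to scalars, $L_{0,0}$ is the unique $\mathrm{ad}$-locally finite element'' means that the set of $\mathrm{ad}$-locally finite elements of $\mathcal{B}$ is $\mathbb{F}L_{0,0}$.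 *)

(* Defs.v *)
From HB Require Import structures.
From mathcomp Require Import all_boot all_order all_algebra finmap.
From mathcomp Require Import monalg.
From mathcomp Require Import ring.

Set Implicit Arguments.
Unset Strict Implicit.
Unset Printing Implicit Defensive.

Import GRing.Theory.
Local Open Scope ring_scope.

HB.mixin Record Lmodule_isLie (R : nzRingType) V of GRing.Lmodule R V := {
  lie : V -> V -> V;
  lie_linearl : forall y, linear (fun x => lie x y);
  lie_linearr : forall x, linear (lie x);
  lie_alternating : forall x, lie x x = 0;
  lie_jacobi : forall x y z,
    lie x (lie y z) + lie y (lie z x) + lie z (lie x y) = 0
}.

#[short(type="lieAlgType")]
HB.structure Definition LieAlgebra (R : nzRingType) :=
  { V of Lmodule_isLie R V & GRing.Lmodule R V }.

Section LinearSpan.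
Variables (F : fieldType) (V : lmodType F).

Definition linear_span (X : V -> Prop) (v : V) : Prop :=
  exists s : seq (F * V),
    (forall p, p \in s -> X p.2) /\ v = \sum_(p <- s) p.1 *: p.2.

Definition finite_dimensional (U : V -> Prop) : Prop :=
  exists b : seq V, forall v, U v <-> linear_span (fun x => x \in b) v.

End LinearSpan.

Section AdjointAction.
Variables (F : fieldType) (V : lieAlgType F).
Implicit Types (S v : V) (f g : V -> V).

Definition ad S : V -> V := lie S.

Definition ad_locally_finite S : Prop :=
  forall v, finite_dimensional
    (linear_span (fun w => exists m : nat, w = iter m (ad S) v)).

Definition ad_locally_nilpotent S : Prop :=
  forall v, exists N : nat, (0 < N)%N && (iter N (ad S) v == 0).

(* The exponential series at v is cut at the first N > 0 with
   (ad S)^N v = 0; all the later terms vanish. *)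
Definition exp_ad S (nilS : ad_locally_nilpotent S) : V -> V :=
  fun v => \sum_(n < ex_minn (nilS v)) (n`!%:R)^-1 *: iter n (ad S) v.

Definition lie_automorphism f : Prop :=
  [/\ linear f, bijective f & forall x y, f (lie x y) = lie (f x) (f y)].

Definition automorphism_subgroup (H : (V -> V) -> Prop) : Prop :=
  [/\ forall f, H f -> lie_automorphism f,
      H id,
      forall f g, H f -> H g -> H (f \o g)
    & forall f g, H f -> cancel f g -> cancel g f -> H g].

Definition inner_automorphism f : Prop :=
  forall H, automorphism_subgroup H ->
    (forall S (nilS : ad_locally_nilpotent S), H (exp_ad nilS)) ->
    H f.

End AdjointAction.

Definition blockB_coef (a : int) (i : nat) (b : int) (j : nat) : int :=
  (a - 1) * (j%:Z + 1) - (b - 1) * (i%:Z + 1).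

(* The Lie axioms of the bracket are checked over an abstract module, where
   unification does not unfold the operations of finitely supported functions. *)
Section BlockAxioms.
Variables (F : fieldType) (V : lmodType F) (e : int * nat -> V).
Variables (b : V -> V -> V) (r : V -> seq (int * nat)).
Variable c : V -> int * nat -> F.
Hypothesis bl : forall y, linear (fun x => b x y).
Hypothesis br : forall x, linear (b x).
Hypothesis e_sum : forall x, x = \sum_(k <- r x) c x k *: e k.
Hypothesis bee : forall k l,
  b (e k) (e l) = (blockB_coef k.1 k.2 l.1 l.2)%:~R *: e (k.1 + l.1, (k.2 + l.2)%N).

Let linear_e_eq0 (f : V -> V) :
  linear f -> (forall k, f (e k) = 0) -> forall x, f x = 0.
Proof.
move=> lf f0 x; rewrite (e_sum x).
have f_0 : f 0 = 0 by have := lf (-1) 0 0; rewrite scaler0 addr0 scaleN1r addNr.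
by elim/big_rec: _ => // k y _ fy; rewrite lf f0 fy scaler0 addr0.
Qed.

Let bD x y z : b (x + y) z = b x z + b y z.
Proof. by have := bl z 1 x y; rewrite !scale1r. Qed.

Let bDr x y z : b z (x + y) = b z x + b z y.
Proof. by have := br z 1 x y; rewrite !scale1r. Qed.

Let b0 z : b 0 z = 0.
Proof. by apply: (addIr (b 0 z)); rewrite -bD !add0r. Qed.

Let b0r z : b z 0 = 0.
Proof. by apply: (addIr (b z 0)); rewrite -bDr !add0r. Qed.

Let bZ a x z : b (a *: x) z = a *: b x z.
Proof. by have := bl z a x 0; rewrite !addr0 b0 addr0. Qed.

Let bZr a x z : b z (a *: x) = a *: b z x.
Proof. by have := br z a x 0; rewrite !addr0 b0r addr0. Qed.

Let b_anti x y : b x y + b y x = 0.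
Proof.
apply: (linear_e_eq0 (f := fun x => b x y + b y x)) => [a u v|k].
  by rewrite bD bDr bZ bZr scalerDr addrACA.
apply: (linear_e_eq0 (f := fun y => b (e k) y + b y (e k))) => [a u v|l].
  by rewrite bD bDr bZ bZr scalerDr addrACA.
rewrite !bee [l.1 + k.1]addrC [(l.2 + k.2)%N]addnC -scalerDl -intrD.
set n : int := (X in X%:~R); suff -> : n = 0 by rewrite scale0r.
by rewrite /n /blockB_coef; ring.
Qed.

Lemma alternating_ext x : b x x = 0.
Proof.
rewrite (e_sum x); elim/big_rec: _ => [|k y _ yy]; first exact: b0.
rewrite bD !bDr yy addr0 -addrA b_anti addr0 bZ bZr bee /blockB_coef.
by rewrite subrr scale0r !scaler0.
Qed.

Lemma jacobi_ext x y z : b x (b y z) + b y (b z x) + b z (b x y) = 0.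
Proof.
pose J x y z := b x (b y z) + b y (b z x) + b z (b x y).
have Jrot u v w : J u v w = J v w u by rewrite /J -addrA addrC.
have Jlin u v : linear (fun x => J x u v).
  move=> a s t; rewrite /J !(bD, bDr, bZ, bZr) !scalerDr.
  by rewrite [X in X + _ = _]addrACA [LHS]addrACA.
rewrite -/(J x y z); apply: (linear_e_eq0 (Jlin y z)) => -[a i].
rewrite Jrot; apply: (linear_e_eq0 (Jlin _ _)) => -[d j].
rewrite Jrot; apply: (linear_e_eq0 (Jlin _ _)) => -[g k].
rewrite /J !bee !bZr !bee !scalerA /=.
have -> : a + (d + g) = g + (a + d) by ring.
have -> : d + (g + a) = g + (a + d) by ring.
have -> : (i + (j + k) = k + (i + j))%N by rewrite addnA addnC.
have -> : (j + (k + i) = k + (i + j))%N by rewrite addnCA [(j + i)%N]addnC.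
rewrite -!scalerDl -!intrM -!intrD; set n : int := (X in X%:~R).
suff -> : n = 0 by rewrite scale0r.
by rewrite /n /blockB_coef !PoszD; ring.
Qed.

End BlockAxioms.

Section BlockAlgebra.
Variable F : fieldType.

(* Finitely supported functions from int * nat to F. *)
Definition blockB : Type := {malg F[(int * nat)%type]}.
HB.instance Definition _ := GRing.Lmodule.on blockB.

Definition L (a : int) (i : nat) : blockB := << (a, i) >>.

Definition blockB_bracket (x y : blockB) : blockB :=
  \sum_(k <- msupp x) \sum_(l <- msupp y)
    (x@_k * y@_l * (blockB_coef k.1 k.2 l.1 l.2)%:~R)
      *: L (k.1 + l.1) (k.2 + l.2).

Let T (x y : blockB) (k l : int * nat) : blockB :=
  (x@_k * y@_l * (blockB_coef k.1 k.2 l.1 l.2)%:~R)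
      *: L (k.1 + l.1) (k.2 + l.2).

Let bracketEw (d1 d2 : {fset (int * nat)}) (x y : blockB) :
  (msupp x `<=` d1)%fset -> (msupp y `<=` d2)%fset ->
  blockB_bracket x y = \sum_(k <- d1) \sum_(l <- d2) T x y k l.
Proof.
move=> s1 s2; rewrite /blockB_bracket (big_fset_incl _ s1) /=; last first.
  move=> k _ /mcoeff_outdom xk; rewrite big1 // => l _.
  by rewrite xk !mul0r scale0r.
apply: eq_bigr => k _; rewrite (big_fset_incl _ s2) //=.
by move=> l _ /mcoeff_outdom yl; rewrite yl mulr0 mul0r scale0r.
Qed.

Let bracket_linearl y : linear (fun x => blockB_bracket x y).
Proof.
move=> a u v; pose d := (msupp u `|` msupp v `|` msupp (a *: u + v))%fset.
have su : (msupp u `<=` d)%fset by rewrite /d -fsetUA fsubsetUl.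
have sv : (msupp v `<=` d)%fset by rewrite /d fsetUAC fsubsetUr.
have sw : (msupp (a *: u + v) `<=` d)%fset by rewrite fsubsetUr.
have sy := fsubset_refl (msupp y).
rewrite (bracketEw su sy) (bracketEw sv sy) (bracketEw sw sy).
rewrite scaler_sumr -big_split /=; apply: eq_bigr => k _.
rewrite scaler_sumr -big_split /=; apply: eq_bigr => l _.
by rewrite /T scalerA -scalerDl mcoeffD mcoeffZ; congr (_ *: _); ring.
Qed.

Let bracket_linearr x : linear (blockB_bracket x).
Proof.
move=> a u v; pose d := (msupp u `|` msupp v `|` msupp (a *: u + v))%fset.
have su : (msupp u `<=` d)%fset by rewrite /d -fsetUA fsubsetUl.
have sv : (msupp v `<=` d)%fset by rewrite /d fsetUAC fsubsetUr.
have sw : (msupp (a *: u + v) `<=` d)%fset by rewrite fsubsetUr.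
have sx := fsubset_refl (msupp x).
rewrite (bracketEw sx su) (bracketEw sx sv) (bracketEw sx sw).
rewrite scaler_sumr -big_split /=; apply: eq_bigr => k _.
rewrite scaler_sumr -big_split /=; apply: eq_bigr => l _.
by rewrite /T scalerA -scalerDl mcoeffD mcoeffZ; congr (_ *: _); ring.
Qed.

Lemma blockB_bracketLL a i b j :
  blockB_bracket (L a i) (L b j) =
  (blockB_coef a i b j)%:~R *: L (a + b) (i + j).
Proof.
rewrite (bracketEw (@msuppU_le _ F (a, i) 1) (@msuppU_le _ F (b, j) 1)).
by rewrite !big_seq_fset1 /T !mcoeffUU !mul1r.
Qed.

Lemma blockB_L_sum (x : blockB) :
  x = \sum_(k <- msupp x) x@_k *: L k.1 k.2.
Proof.
rewrite [LHS]monalgE; apply: eq_bigr => -[a i] _ /=.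
apply/malgP => k; rewrite mcoeffZ !mcoeffU.
by case: eqP => _; rewrite ?mulr1n ?mulr1 ?mulr0n ?mulr0.
Qed.

Let coefP k l : int := blockB_coef k.1 k.2 l.1 l.2.
Let e (k : int * nat) : blockB := L k.1 k.2.

Let bracketLL k l :
  blockB_bracket (e k) (e l) = (coefP k l)%:~R *: e (k.1 + l.1, (k.2 + l.2)%N).
Proof. exact: blockB_bracketLL. Qed.

Let bracket_alternating x : blockB_bracket x x = 0.
Proof.
exact: (alternating_ext bracket_linearl bracket_linearr blockB_L_sum bracketLL).
Qed.

Let bracket_jacobi x y z :
  blockB_bracket x (blockB_bracket y z) + blockB_bracket y (blockB_bracket z x)
  + blockB_bracket z (blockB_bracket x y) = 0.
Proof.
exact: (jacobi_ext bracket_linearl bracket_linearr blockB_L_sum bracketLL).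
Qed.

HB.instance Definition _ := Lmodule_isLie.Build F blockB
  bracket_linearl bracket_linearr bracket_alternating bracket_jacobi.

Lemma lieLL a i b j :
  lie (L a i) (L b j) =
  ((a - 1) * (j%:Z + 1) - (b - 1) * (i%:Z + 1))%:~R *: L (a + b) (i + j).
Proof. exact: blockB_bracketLL. Qed.

End BlockAlgebra.

Arguments L {F} a%_R i%_N.

(* Main.v *)
(* Give Z x Z+ an additive functional that is injective on the support of [S].
   If [L e] is the leading term of [S] and the structure constant of [L e] and
   [L (p + m e)] vanishes for no [m], then [ad S ^ m (L p)] has leading term
   [L (p + m e)].  This structure constant is affine in [m], and a suitable [p]
   keeps it away from zero.  Replacing the functional by its opposite if needed,
   [e <> (0, 0)] unless [S] is a multiple of [L 0 0]; then infinitely many basis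
   vectors occur in the orbit.  Conversely [L 0 0] is diagonal in the basis, so
   the orbit of any vector satisfies a polynomial relation. *)
Require Import Defs.
From mathcomp Require Import all_boot all_order all_algebra.
From mathcomp Require Import finmap monalg zify ring.
From Stdlib Require Import FunctionalExtensionality.
Import Order.TTheory GRing.Theory Num.Theory.
Local Open Scope ring_scope.

Set Implicit Arguments.
Unset Strict Implicit.
Unset Printing Implicit Defensive.

(** * Linear combinations, and scalars in characteristic zero *)

Section LinearSpan.
Variables (F : fieldType) (V : lmodType F).
Implicit Types (X Y : V -> Prop) (u v : V).

Lemma linear_span_mem X v : X v -> linear_span X v.
Proof.
move=> Xv; exists [:: (1, v)]; split=> [p|]; last by rewrite big_seq1 scale1r.
by rewrite inE => /eqP ->.
Qed.

Lemma linear_span_sum X (I : eqType) (r : seq I) (c : I -> F) (x : I -> V) :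
  (forall i, i \in r -> linear_span X (x i)) ->
  linear_span X (\sum_(i <- r) c i *: x i).
Proof.
elim: r => [|i r IHr] Xx; first by exists [::]; rewrite !big_nil.
have [|s [Xs Es]] := IHr; first by move=> j rj; apply: Xx; rewrite inE rj orbT.
have [t [Xt Et]] := Xx i (mem_head i r).
exists ([seq (c i * p.1, p.2) | p <- t] ++ s); split=> [p|].
  by rewrite mem_cat => /orP[/mapP[q tq ->]|]; [exact: (Xt q) | exact: Xs].
rewrite big_cons Es {1}Et big_cat big_map scaler_sumr; congr (_ + _).
by apply: eq_bigr => p _; rewrite scalerA.
Qed.

Lemma linear_span_sub X Y v :
  (forall x, X x -> linear_span Y x) -> linear_span X v -> linear_span Y v.
Proof.
by move=> sXY [s [Xs ->]]; apply: linear_span_sum => p /Xs; apply: sXY.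
Qed.

End LinearSpan.

Lemma lieZl (F : fieldType) (V : lieAlgType F) (a : F) (x y : V) :
  lie (a *: x) y = a *: lie x y.
Proof.
have D u v : lie (u + v) y = lie u y + lie v y.
  by have := lie_linearl y 1 u v; rewrite !scale1r.
have l0 : lie 0 y = 0 by apply: (addIr (lie 0 y)); rewrite -D !add0r.
by have := lie_linearl y a x 0; rewrite !addr0 l0 addr0.
Qed.

Lemma intr_pchar0_neq0 (F : fieldType) (n : int) :
  [pchar F] =i pred0 -> n != 0 -> n%:~R != 0 :> F.
Proof.
move=> /pcharf0P F0; case: n => n n0; first by rewrite -pmulrn F0.
by rewrite NegzE mulrNz oppr_eq0 -pmulrn F0.
Qed.

(** * Additive weights separating finitely many indices *)

Lemma strict_argmax (T : eqType) (s : seq T) (f : T -> int) :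
  s != [::] -> {in s &, injective f} ->
  exists2 e, e \in s & forall k, k \in s -> k != e -> (f k < f e)%R.
Proof.
elim: s => // x [|y s] IHs _ finj.
  by exists x; rewrite ?mem_head // => k; rewrite inE => ->.
have [//|k l sk sl|e se emax] := IHs.
  by apply: finj; rewrite inE ?sk ?sl orbT.
have [fxe|fex] := boolP (f x < f e).
  exists e; first by rewrite inE se orbT.
  by move=> k; rewrite inE => /orP[/eqP -> //|/emax].
exists x => [|k]; first exact: mem_head.
rewrite inE => /orP[-> //|sk kx].
have fkx : f k <> f x.
  move=> /finj Ekx; move: kx; rewrite Ekx ?eqxx ?mem_head //.
  by rewrite inE sk orbT.
move: fex; rewrite -leNgt => fex.
have [Eke|/(emax _ sk)] := eqVneq k e; last by lia.
by move: fkx fex; rewrite Eke; lia.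
Qed.

Definition index_add (k l : int * nat) : int * nat :=
  (k.1 + l.1, (k.2 + l.2)%N).

(** Taking [s] to be 1 or -1 exchanges the functional with its opposite. *)
Definition weight (s K : int) (k : int * nat) : int :=
  s * (K * k.1 + k.2%:Z).

Lemma weightD s K k l :
  weight s K (index_add k l) = weight s K k + weight s K l.
Proof. by rewrite /weight /= PoszD; ring. Qed.

(** The multiplier exceeds every second component in [r], so both components can be recovered as in
    a positional expansion. *)
Lemma weight_inj (s : int) (r : seq (int * nat)) :
  s != 0 ->
  {in r &, injective (weight s (1 + \sum_(k <- r) k.2)%N)}.
Proof.
move=> s0; set K := (1 + _)%N.
have ltK k : k \in r -> (k.2 < K)%N.
  by move=> rk; rewrite /K (big_rem k) //=; lia.
move=> [a i] [b j] /ltK /= iK /ltK /= jK /(mulfI s0) /= E.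
have Eab : a = b by nia.
by move: E; rewrite Eab => /addrI[->].
Qed.

(** * Leading terms under the adjoint action *)

Section Orbits.
Variable F : fieldType.
Hypothesis charF0 : [pchar F] =i pred0.
Implicit Types (S v w : blockB F) (e p q k l : int * nat).

Lemma mcoeff_L (a : int) (i : nat) q : (L a i : blockB F)@_q = ((a, i) == q)%:R.
Proof. by rewrite mcoeffU. Qed.

Lemma mcoeff_lie S w q :
  (lie S w : blockB F)@_q =
  \sum_(k <- msupp S) \sum_(l <- msupp w)
     S@_k * w@_l * (blockB_coef k.1 k.2 l.1 l.2)%:~R
     * (index_add k l == q)%:R.
Proof.
rewrite [lie S w]/(blockB_bracket S w) /blockB_bracket raddf_sum.
apply: eq_bigr => k _; rewrite raddf_sum; apply: eq_bigr => l _.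
by rewrite /= mcoeffZ mcoeff_L.
Qed.

Definition leading (f : int * nat -> int) w p :=
  w@_p != 0 /\ forall k, w@_k != 0 -> k != p -> f k < f p.

Lemma leading_le f w p k : leading f w p -> w@_k != 0 -> f k <= f p.
Proof.
move=> [_ wmax] wk; have [->//|] := eqVneq k p.
by move=> /(wmax _ wk) /ltW.
Qed.

(** By additivity and strictness of both maxima, [(e, p)] is the only pair from the two supports
    whose weight reaches [f e + f p]. Hence nothing cancels at [index_add e p], and its coefficient
    is a product of three nonzero factors. *)
Lemma leading_lie f S w e p :
  (forall k l, f (index_add k l) = f k + f l) ->
  leading f S e -> leading f w p -> blockB_coef e.1 e.2 p.1 p.2 != 0 ->
  leading f (lie S w) (index_add e p).
Proof.
move=> fD lS lw cep.
have top k l : k \in msupp S -> l \in msupp w ->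
    f (index_add e p) <= f (index_add k l) -> k = e /\ l = p.
  rewrite -!mcoeff_neq0 => Sk wl; rewrite !fD.
  have := leading_le lS Sk; have := leading_le lw wl.
  have [->|/(lS.2 _ Sk)] := eqVneq k e; last by lia.
  by have [->|/(lw.2 _ wl)] := eqVneq l p; [|lia].
split=> [|q]; last first.
  move=> nzq qep; rewrite ltNge; apply: contra nzq => le_ep_q.
  rewrite mcoeff_lie big_seq big1 // => k Sk; rewrite big_seq big1 // => l wl.
  case: eqP => [E|_]; last by rewrite mulr0.
  have [Ek El] : k = e /\ l = p by apply: top; rewrite ?E.
  by case/eqP: qep; rewrite -E Ek El.
have [Se wp] : e \in msupp S /\ p \in msupp w.
  by rewrite -!mcoeff_neq0; split; [case: lS|case: lw].
rewrite mcoeff_lie (bigD1_seq e) ?fset_uniq //= [X in _ + X]big_seq_cond.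
rewrite [X in _ + X]big1 => [|k /andP[Sk ke]]; last first.
  rewrite big_seq big1 // => l wl; case: eqP => [E|_]; last by rewrite mulr0.
  by case: (top k l) ke => //; [rewrite E | move=> ->; rewrite eqxx].
rewrite addr0 (bigD1_seq p) ?fset_uniq //= [X in _ + X]big_seq_cond.
rewrite [X in _ + X]big1 => [|l /andP[wl lp]]; last first.
  case: eqP => [E|_]; last by rewrite mulr0.
  by case: (top e l) lp => //; [rewrite E | move=> _ ->; rewrite eqxx].
rewrite addr0 eqxx mulr1 !mulf_neq0 ?mcoeff_neq0 //.
exact: intr_pchar0_neq0.
Qed.

Lemma iter_index_add e p m :
  iter m (index_add e) p = (e.1 *+ m + p.1, (e.2 * m + p.2)%N).
Proof.
elim: m => [|m IHm] /=; first by rewrite muln0 add0r -surjective_pairing.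
by rewrite IHm /index_add /= mulrS addrA mulnS addnA.
Qed.

Lemma iter_index_add_inj e p :
  e != (0, 0%N) -> injective (fun m => iter m (index_add e) p).
Proof.
case: e => a i e0 m n; rewrite !iter_index_add /= => -[/addIr + /addIn].
have [i0|i0 _ /eqP] := eqVneq i 0%N; last first.
  by rewrite eqn_pmul2l ?lt0n // => /eqP.
have a0 : a != 0 by apply: contra e0 => /eqP ->; rewrite i0.
by rewrite !pmulrn !mulrzz => /(mulfI a0) [].
Qed.

(** The condition on [e] is an implication, so that the nonvanishing of the orbit also covers
    multiples of [L 0 0], as nilpotency requires. *)
Lemma orbit_leading S : S != 0 ->
  exists e p,
    ((exists2 k, S@_k != 0 & k != (0, 0%N)) -> e != (0, 0%N))
    /\ forall m, (iter m (ad S) (L p.1 p.2) : blockB F)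
                   @_(iter m (index_add e) p) != 0.
Proof.
move=> S0.
pose K := (1 + \sum_(k <- msupp S) k.2)%N.
have max_weight (s : int) : s != 0 -> exists e, leading (weight s K) S e.
  move=> s0; have [||e Se emax] := @strict_argmax _ (msupp S) (weight s K).
  - apply: contra S0 => /eqP S0; apply/eqP/malgP => k; rewrite mcoeff0.
    by apply: mcoeff_outdom; rewrite -[_ \in _]/(k \in (msupp S : seq _)) S0.
  - exact: weight_inj.
  by exists e; split=> [|k]; rewrite mcoeff_neq0 //; apply: emax.
have [e [e0 le]] : exists e, ((exists2 k, S@_k != 0 & k != (0, 0%N)) ->
   e != (0, 0%N)) /\ exists s, leading (weight s K) S e.
  have [e le] := max_weight 1 isT; have [e' le'] := max_weight (-1) isT.
  have [e0|e0] := eqVneq e (0, 0%N); last by exists e; split=> //; exists 1.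
  exists e'; split; last by exists (-1).
  (* If [(0, 0)] led for both signs, [K * k.1 + k.2] would be both negative and positive. *)
  case=> k Sk k0; apply/negP => /eqP e0'.
  move: (le.2 _ Sk) (le'.2 _ Sk); rewrite e0 e0' => /(_ k0) + /(_ k0).
  by rewrite /weight /=; lia.
have {le} [s le] := le.
have [p cp] : exists p, forall m, let q := iter m (index_add e) p in
    blockB_coef e.1 e.2 q.1 q.2 != 0.
  (* Start from [p = (b, 0)]: the slope in [m] is [-(e.2 + e.1)] whatever [b] is, so [b] is free to
     give the constant term the sign of the slope. *)
  suff [b cb] : exists b : int, forall m : nat,
      (e.1 - 1) - (b - 1) * (e.2%:Z + 1) - m%:Z * (e.2%:Z + e.1) != 0.
    exists (b, 0%N) => m; rewrite iter_index_add /= /blockB_coef addn0 PoszM.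
    rewrite pmulrn mulrzz; move: (cb m); congr (_ != _); ring.
  move: e.1 e.2 => a n; case: (ltgtP (n%:Z + a) 0) => [an|an|an].
  (* Positive slope: the constant term is at least 1. *)
  - exists (- 1 - `|a|) => m.
    have : m%:Z * (n%:Z + a) <= 0 by rewrite mulr_ge0_le0 // ltW.
    have : 0 <= (2 + `|a|) * n%:Z by rewrite mulr_ge0.
    set u := _ * _; set w := m%:Z * _ => u0 w0.
    rewrite (_ : (- 1 - `|a| - 1) * (n%:Z + 1) = - u - (2 + `|a|)); last first.
      by rewrite /u; ring.
    by lia.
  (* Negative slope: the constant term is at most -2. *)
  - exists (2 + `|a|) => m.
    have : 0 <= m%:Z * (n%:Z + a) by rewrite mulr_ge0 // ltW.
    have : 0 <= (1 + `|a|) * n%:Z by rewrite mulr_ge0.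
    set u := _ * _; set w := m%:Z * _ => u0 w0.
    rewrite (_ : (2 + `|a| - 1) * (n%:Z + 1) = u + (1 + `|a|)); last first.
      by rewrite /u; ring.
    by lia.
  (* Zero slope: the value is constantly [a - 1 = - n - 1]. *)
  - by exists 1 => m; rewrite an mulr0 subrr mul0r; lia.
exists e, p; split=> // m.
suff: leading (weight s K) (iter m (ad S) (L p.1 p.2)) (iter m (index_add e) p).
  by case.
elim: m => [|m IHm] /=.
  split; first by rewrite mcoeff_L -surjective_pairing eqxx oner_eq0.
  move=> k; rewrite mcoeff_L -surjective_pairing.
  by case: (eqVneq p k) => [->|]; rewrite ?eqxx.
by apply: leading_lie => //; apply: weightD.
Qed.

(** * The diagonal action of [L 0 0] *)

Lemma ad_scale_L00 (c : F) v q m :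
  (iter m (ad (c *: L 0 0)) v : blockB F)@_q =
  (- c * (q.2%:Z + q.1)%:~R) ^+ m * v@_q.
Proof.
elim: m => [|m IHm] in q *; first by rewrite expr0 mul1r.
rewrite /= exprS -mulrA -IHm; set w := iter m _ v.
rewrite /ad lieZl mcoeffZ mulNr -mulrN -mulrA; congr (_ * _).
(* [L a i] is an eigenvector of [ad (L 0 0)] with eigenvalue [-(a + i)], so only the index [q] of
   [w] contributes at [q]. *)
rewrite mcoeff_lie msuppU oner_eq0 big_seq_fset1 mcoeff_L eqxx.
have E l : index_add (0, 0%N) l = l by case: l => a i; rewrite /index_add add0r.
have [wq|wq] := msuppP w q; last first.
  rewrite mulr0 big_seq big1 // => l wl; rewrite E.
  by case: eqP wl => [->|]; [rewrite (negbTE wq) | rewrite mulr0].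
rewrite (bigD1_seq q) ?fset_uniq //= big1 => [|l lq]; last first.
  by rewrite E (negbTE lq) mulr0.
rewrite addr0 E eqxx mulr1 mul1r mulrC; congr (_ * _).
by rewrite -mulrNz; congr (_%:~R); rewrite /blockB_coef; ring.
Qed.

Lemma ad_locally_finite_L00 (c : F) : ad_locally_finite (c *: L 0 0 : blockB F).
Proof.
move=> v; set S := c *: _.
(* These are the eigenvalues of [ad S] on the support of [v], possibly repeated; [P] evaluated at
   [ad S] therefore kills [v]. *)
pose r : seq F := [seq - c * (q.2%:Z + q.1)%:~R | q <- msupp v].
pose P := \prod_(x <- r) ('X - x%:P).
exists [seq iter m (ad S) v | m <- iota 0 (size r)] => u; split; last first.
  apply: linear_span_sub => _ /mapP[m _ ->].
  by apply: linear_span_mem; exists m.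
apply: linear_span_sub => _ [m ->].
(* The remainder agrees with ['X^m] at every root of [P], and its degree is below [size r], so the
   first [size r] iterates suffice. *)
pose R := 'X^m %% P.
have -> : iter m (ad S) v = \sum_(i <- iota 0 (size r)) R`_i *: iter i (ad S) v.
  have P0 : P != 0 by rewrite monic_neq0 // monic_prod_XsubC.
  have sR : (size R <= size r)%N.
    by rewrite -ltnS -(size_prod_XsubC r idfun) ltn_modp.
  apply/malgP => q; rewrite raddf_sum /= ad_scale_L00.
  have [vq|vq] := boolP (q \in msupp v); last first.
    rewrite (mcoeff_outdom vq) mulr0 big1 // => i _.
    by rewrite mcoeffZ ad_scale_L00 (mcoeff_outdom vq) !mulr0.
  set x := - c * _; have Px : P.[x] = 0.
    by apply/rootP; rewrite root_prod_XsubC; apply: (map_f _ vq).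
  have -> : x ^+ m = R.[x].
    by rewrite -hornerXn {1}(divp_eq 'X^m P) hornerD hornerM Px mulr0 add0r.
  rewrite (horner_coef_wide _ sR) mulr_suml -[X in iota 0 X]subn0 big_mkord.
  by apply: eq_bigr => i _; rewrite mcoeffZ ad_scale_L00 mulrA.
apply: linear_span_sum => i ri; apply: linear_span_mem; exact: map_f.
Qed.

(** * Classification of locally finite and locally nilpotent elements *)

Lemma ad_locally_finite_scale_L00 S :
  ad_locally_finite S -> exists c : F, S = c *: L 0 0.
Proof.
move=> finS; have [Sk|S0] := boolP (all (pred1 (0, 0%N)) (msupp S)).
  exists S@_(0, 0%N); apply/malgP => k; rewrite mcoeffZ mcoeff_L.
  case: eqVneq => [<-|k0]; first by rewrite mulr1.
  rewrite mulr0; apply: mcoeff_outdom; apply/negP => /(allP Sk) /= /eqP Ek.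
  by rewrite Ek eqxx in k0.
have {}S0 : exists2 k, S@_k != 0 & k != (0, 0%N).
  by case/allPn: S0 => k Sk k0; exists k; rewrite // mcoeff_neq0.
have [|e [p [e0 orbit]]] := @orbit_leading S.
  by case: S0 => k Sk _; apply: contraNneq Sk => ->; rewrite mcoeff0.
have {S0}e0 := e0 S0.
have [b spanb] := finS (L p.1 p.2).
pose s : seq (int * nat) :=
  flatten [seq (msupp (x : blockB F) : seq _) | x <- b].
(* Pigeonhole: these are [size s + 1] distinct indices, yet each has a nonzero coefficient in a
   combination of [b] and so must lie in [s]. *)
pose q := [seq iter m (index_add e) p | m <- iota 0 (size s).+1].
have uq : uniq q.
  by rewrite map_inj_uniq ?iota_uniq //; apply: iter_index_add_inj.
suff sqs : {subset q <= s}.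
  by have := uniq_leq_size uq sqs; rewrite size_map size_iota ltnn.
move=> _ /mapP[m _ ->].
have [|t [tb Et]] := (spanb (iter m (ad S) (L p.1 p.2))).1.
  by apply: linear_span_mem; exists m.
have := orbit m; rewrite Et raddf_sum /=; apply: contraNT => notin.
rewrite big_seq big1 // => x tx; rewrite mcoeffZ mcoeff_outdom ?mulr0 //.
apply: contra notin => xq; apply/flatten_mapP; exists x.2 => //; exact: tb.
Qed.

Lemma ad_locally_nilpotent_eq0 S : ad_locally_nilpotent S -> S = 0.
Proof.
move=> nilS; apply/eqP; apply: contraT => /orbit_leading [e [p [_ orbit]]].
have [n /andP[_ /eqP En]] := nilS (L p.1 p.2).
by have := orbit n; rewrite En mcoeff0 eqxx.
Qed.

Lemma exp_ad_id S (nilS : ad_locally_nilpotent S) : exp_ad nilS = id.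
Proof.
have adS0 n v : iter n.+1 (ad S) v = 0.
  (* Zero is written as a multiple of [L 0 0] to reuse the diagonal formula, whose factor becomes a
     positive power of 0. *)
  have -> : S = 0 *: L 0 0 by rewrite scale0r (ad_locally_nilpotent_eq0 nilS).
  apply/malgP => q; rewrite (ad_scale_L00 0).
  by rewrite oppr0 mul0r expr0n mul0r mcoeff0.
apply: functional_extensionality => v; rewrite /exp_ad.
(* The cutoff is positive, so the term of order 0 is always present. *)
case: ex_minnP => -[|n] // _ _; rewrite big_ord_recl big1 => [|i _].
  by rewrite fact0 invr1 scale1r addr0.
by rewrite lift0 adS0 scaler0.
Qed.

(** Every exponential is [id], so the trivial subgroup already contains all the generators. *)
Lemma inner_automorphismP (f : blockB F -> blockB F) :
  inner_automorphism f <-> f = id.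
Proof.
split=> [/(_ (fun g => g = id)) innerf|-> H [_ Hid _ _] _ //].
apply: innerf; last by move=> S nilS; apply: exp_ad_id.
split=> // [g ->|g h -> -> //|g h -> gh _].
  split=> //; exact: (Bijective (g := id)).
by apply: functional_extensionality => x; apply: gh.
Qed.

End Orbits.

Theorem lemma3p1 (F : closedFieldType) (charF0 : [pchar F] =i pred0) :
  (forall S : blockB F,
     ad_locally_finite S <-> exists c : F, S = c *: L 0 0)
  /\ (forall S : blockB F, ad_locally_nilpotent S -> S = 0)
  /\ (forall f : blockB F -> blockB F, inner_automorphism f <-> f = id).
Proof.
split=> [S|]; first split=> [|[c ->]].
- exact: ad_locally_finite_scale_L00.
- exact: ad_locally_finite_L00.
split=> [S|f]; first exact: ad_locally_nilpotent_eq0.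
exact: inner_automorphismP.
Qed.
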